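(* Let $(X,d)$ be a metric space, $V$ a Banach space and $Y=X\times V$. Let $C=(\varphi,\Phi)$ be a skew-evolution semiflow on $Y$ with the property that for all $(t_0,x,v)\in\mathbb{R}_+\times Y$ the mapping $s\mapsto\|\Phi(s,t_0,x)v\|$ (defined for $s\ge t_0$) is measurable. Then $C$ is uniformly exponentially trichotomic if and only if there exist three projector families $\{P_k\}_{k\in\{1,2,3\}}$ compatible with $C$, constants $N,M\ge 1$ and a nondecreasing function $g:[0,\infty)\to(1,\infty)$ with $\lim_{t\to\infty}g(t)=\infty$ such that (i) $\|\Phi(t,t_0,x)P_1(x)v\|\le N\|P_1(x)v\|$ and $\int_s^t\|\Phi(\tau,t_0,x)P_1(x)v\|\,d\tau\le M\|\Phi(s,t_0,x)P_1(x)v\|$, (ii) $\|P_2(x)v\|\le N\|\Phi(t,t_0,x)P_2(x)v\|$ and $\int_s^t\|\Phi(\tau,t_0,x)P_2(x)v\|\,d\tau\le M\|\Phi(t,t_0,x)P_2(x)v\|$, (iii) $\|\Phi(t,t_0,x)P_3(x)v\|\le g(t-s)\|\Phi(s,t_0,x)P_3(x)v\|$ and $\|\Phi(s,t_0,x)P_3(x)v\|\le g(t-s)\|\Phi(t,t_0,x)P_3(x)v\|$, for all $t\ge s\ge t_0\ge 0$ and all $(x,v)\in Y$.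
   Context: $(X,d)$ is a metric space, $V$ a Banach space, $\mathcal{B}(V)$ the space of bounded linear operators from $V$ into itself, $T=\{(t,t_0)\in\mathbb{R}^2: t\ge t_0\ge 0\}$ and $Y=X\times V$. An evolution semiflow on $X$ is a mapping $\varphi:T\times X\to X$ such that $\varphi(t,t,x)=x$ for all $(t,x)\in\mathbb{R}_+\times X$, and $\varphi(t,s,\varphi(s,t_0,x))=\varphi(t,t_0,x)$ for all $t\ge s\ge t_0\ge 0$, $x\in X$. An evolution cocycle over an evolution semiflow $\varphi$ is a mapping $\Phi:T\times X\to\mathcal{B}(V)$ such that $\Phi(t,t,x)=I$ (the identity operator on $V$) for all $(t,x)\in\mathbb{R}_+\times X$, and $\Phi(t,s,\varphi(s,t_0,x))\Phi(s,t_0,x)=\Phi(t,t_0,x)$ for all $t\ge s\ge t_0\ge 0$, $x\in X$. The skew-evolution semiflow $C=(\varphi,\Phi)$ on $Y$ is the mapping $C:T\times Y\to Y$, $C(t,s,x,v)=(\varphi(t,s,x),\Phi(t,s,x)v)$, where $\Phi$ is an evolution cocycle over the evolution semiflow $\varphi$. A projector (projector family) is a mapping $P:Y\to Y$ of the form $P(x,v)=(x,P(x)v)$, where for each $x\in X$, $P(x)$ is a projection (idempotent linear operator) on the fiber $Y_x=\{x\}\times V$, identified with $V$. Three projector families $\{P_k\}_{k\in\{1,2,3\}}$ are compatible with $C=(\varphi,\Phi)$ if $P_1(x)+P_2(x)+P_3(x)=I$, $P_i(x)P_j(x)=P_j(x)P_i(x)=0$ for $i,j\in\{1,2,3\}$,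 $i\ne j$, and $P_k(\varphi(t,s,x))\Phi(t,s,x)v=\Phi(t,s,x)P_k(x)v$ for $k\in\{1,2,3\}$, for all $t\ge s\ge 0$ and all $(x,v)\in Y$. $C=(\varphi,\Phi)$ is uniformly exponentially trichotomic if there exist three projector families $\{P_k\}_{k\in\{1,2,3\}}$ compatible with $C$ and constants $N_1,N_2,N_3\ge 1$, $\nu_1,\nu_2,\nu_3>0$ such that, for all $t\ge s\ge t_0\ge 0$ and all $(x,v)\in Y$, $$e^{\nu_1(t-s)}\|\Phi(t,t_0,x)P_1(x)v\|\le N_1\|\Phi(s,t_0,x)P_1(x)v\|,$$ $$e^{\nu_2(t-s)}\|\Phi(s,t_0,x)P_2(x)v\|\le N_2\|\Phi(t,t_0,x)P_2(x)v\|,$$ $$\|\Phi(t,t_0,x)P_3(x)v\|\le N_3e^{\nu_3(t-s)}\|\Phi(s,t_0,x)P_3(x)v\|,$$ $$\|\Phi(s,t_0,x)P_3(x)v\|\le N_3e^{\nu_3(t-s)}\|\Phi(t,t_0,x)P_3(x)v\|.$$ *)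

(* Defs.v *)
From HB Require Import structures.
From mathcomp Require Export all_boot all_order all_algebra.
From mathcomp Require Export all_classical all_reals all_analysis.
From mathcomp Require Import complex.

Set Implicit Arguments.
Unset Strict Implicit.
Unset Printing Implicit Defensive.

Export Order.TTheory GRing.Theory Num.Theory.
Export numFieldNormedType.Exports.

Local Open Scope classical_set_scope.
Local Open Scope ring_scope.

(* A Banach space is over the real or over the complex numbers: it is an
   element of completeNormedModType (scalar_field R k). *)
Inductive scalar_kind := RealScalars | ComplexScalars.

Definition scalar_field (R : realType) (k : scalar_kind) : numFieldType :=
  match k with RealScalars => R | ComplexScalars => R[i] end.

(* The norm of a normed module over K takes its values in K; over R[i] these
   values are nonnegative reals, so that taking the real part loses nothing. *)
Definition real_part (R : realType) (k : scalar_kind) :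
    scalar_field R k -> R :=
  match k with
  | RealScalars => fun a : R => a
  | ComplexScalars => fun a : R[i] => complex.Re a
  end.

Definition rnorm (R : realType) (k : scalar_kind)
    (V : normedModType (scalar_field R k)) (v : V) : R :=
  real_part `|v|.

Definition bounded_operator (R : realType) (k : scalar_kind)
    (V : normedModType (scalar_field R k)) (A : {linear V -> V}) : Prop :=
  exists M : R, forall v : V, rnorm (A v) <= M * rnorm v.

(* Maps on T = {(t, t0) | t >= t0 >= 0} are represented by total functions of
   two real variables, about which nothing is required (and of which nothing
   is used) outside T. *)
Definition evolution_semiflow (R : realType) (X : Type)
    (phi : R -> R -> X -> X) : Prop :=
  (forall t x, 0 <= t -> phi t t x = x) /\
  (forall t s t0 x, 0 <= t0 -> t0 <= s -> s <= t ->
     phi t s (phi s t0 x) = phi t t0 x).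

Definition evolution_cocycle (R : realType) (k : scalar_kind) (X : Type)
    (V : normedModType (scalar_field R k)) (phi : R -> R -> X -> X)
    (Phi : R -> R -> X -> {linear V -> V}) : Prop :=
  [/\ forall t t0 x, 0 <= t0 -> t0 <= t -> bounded_operator (Phi t t0 x),
      forall t x v, 0 <= t -> Phi t t x v = v &
      forall t s t0 x v, 0 <= t0 -> t0 <= s -> s <= t ->
        Phi t s (phi s t0 x) (Phi s t0 x v) = Phi t t0 x v].

Record skew_evolution_semiflow (R : realType) (k : scalar_kind) (X : Type)
    (V : normedModType (scalar_field R k)) := SkewEvolutionSemiflow {
  semiflow : R -> R -> X -> X;
  cocycle : R -> R -> X -> {linear V -> V};
  semiflowP : evolution_semiflow semiflow;
  cocycleP : evolution_cocycle semiflow cocycle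
}.

Definition skew_map (R : realType) (k : scalar_kind) (X : Type)
    (V : normedModType (scalar_field R k)) (C : skew_evolution_semiflow X V)
    (t s : R) (y : X * V) : X * V :=
  (semiflow C t s y.1, cocycle C t s y.1 y.2).

Coercion skew_map : skew_evolution_semiflow >-> Funclass.

(* The projector (x, v) |-> (x, P x v) of X * V is given by its fibre maps. *)
Definition projector_family (R : realType) (k : scalar_kind) (X : Type)
    (V : normedModType (scalar_field R k)) (P : X -> {linear V -> V}) : Prop :=
  forall x v, P x (P x v) = P x v.

Definition orthogonal_families (R : realType) (k : scalar_kind) (X : Type)
    (V : normedModType (scalar_field R k)) (P Q : X -> {linear V -> V}) :
    Prop :=
  forall x v, P x (Q x v) = 0 /\ Q x (P x v) = 0.

Definition intertwines (R : realType) (k : scalar_kind) (X : Type)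
    (V : normedModType (scalar_field R k)) (C : skew_evolution_semiflow X V)
    (P : X -> {linear V -> V}) : Prop :=
  forall t s x v, 0 <= s -> s <= t ->
    P (semiflow C t s x) (cocycle C t s x v) = cocycle C t s x (P x v).

Definition compatible (R : realType) (k : scalar_kind) (X : Type)
    (V : normedModType (scalar_field R k)) (C : skew_evolution_semiflow X V)
    (P1 P2 P3 : X -> {linear V -> V}) : Prop :=
  [/\ [/\ projector_family P1, projector_family P2 & projector_family P3],
      forall x v, P1 x v + P2 x v + P3 x v = v,
      [/\ orthogonal_families P1 P2, orthogonal_families P1 P3
        & orthogonal_families P2 P3] &
      [/\ intertwines C P1, intertwines C P2 & intertwines C P3]].

Definition uniformly_exponentially_trichotomic (R : realType)
    (k : scalar_kind) (X : Type) (V : normedModType (scalar_field R k))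
    (C : skew_evolution_semiflow X V) : Prop :=
  exists P1 P2 P3 : X -> {linear V -> V},
  exists N1 N2 N3 nu1 nu2 nu3 : R,
  [/\ compatible C P1 P2 P3,
      [/\ 1 <= N1, 1 <= N2 & 1 <= N3],
      [/\ 0 < nu1, 0 < nu2 & 0 < nu3] &
      forall t s t0 x v, 0 <= t0 -> t0 <= s -> s <= t ->
      [/\ expR (nu1 * (t - s)) * rnorm (cocycle C t t0 x (P1 x v))
            <= N1 * rnorm (cocycle C s t0 x (P1 x v)),
          expR (nu2 * (t - s)) * rnorm (cocycle C s t0 x (P2 x v))
            <= N2 * rnorm (cocycle C t t0 x (P2 x v)),
          rnorm (cocycle C t t0 x (P3 x v))
            <= N3 * expR (nu3 * (t - s)) * rnorm (cocycle C s t0 x (P3 x v)) &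
          rnorm (cocycle C s t0 x (P3 x v))
            <= N3 * expR (nu3 * (t - s)) * rnorm (cocycle C t t0 x (P3 x v))]].

(* Measurability on D with respect to the Lebesgue sigma-algebra, which is the
   one completed_lebesgue_measure lives on: the library's own measurable
   structure on R is the smaller Borel one. *)
Definition lebesgue_measurable_fun (R : realType) (D : set R) (f : R -> R) :
    Prop :=
  @measurable_fun _ _ (caratheodory_type (@wlength R idfun)^*%mu) R D f.

(* Main.v *)
Require Import Defs.
From mathcomp Require Import measurable_realfun ring lra.

(* Write f s for the norm of Phi(s, t0, x) P_k(x) v. The cocycle identity and
   the invariance of P_k let every estimate be restarted at a later time, so
   that f t <= N f s for all t >= s >= t0 when k = 1. Integrating this
   inequality gives (t - s) f t <= N (int_s^t f) <= N M f s; hence f is at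
   least halved over any time step of length 2 N M, and iterating yields
   exponential decay. The case k = 2 is the same with time reversed, and for
   k = 3 the bound g 1 over unit steps is iterated. Conversely, exponential
   bounds integrate to the required integral estimates. *)

Set Implicit Arguments.
Unset Strict Implicit.
Unset Printing Implicit Defensive.

Local Open Scope classical_set_scope.
Local Open Scope ring_scope.

(** * Borel functions under the completed Lebesgue measure *)

Lemma borel_lebesgue_measurable (R : realType) (A : set R) :
  measurable A -> @measurable _ (caratheodory_type (@wlength R idfun)^*%mu) A.
Proof. exact: sub_caratheodory. Qed.

Lemma lebesgue_measurable_id (R : realType) :
  @measurable_fun _ _ (caratheodory_type (@wlength R idfun)^*%mu) R setT idfun.
Proof.
by move=> _ A mA; rewrite setTI; exact: borel_lebesgue_measurable.
Qed.

Lemma lebesgue_measurableT_comp (R : realType) d (U : measurableType d)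
    (D : set R) (f : R -> U) :
  measurable_fun setT f ->
  @measurable_fun _ _ (caratheodory_type (@wlength R idfun)^*%mu) U D f.
Proof.
move=> mf; apply: measurable_funTS.
exact: (measurableT_comp mf (@lebesgue_measurable_id R)).
Qed.

(** The identity map is measurable from the Lebesgue to the Borel sigma-algebra, and it pushes the
    completed measure forward to [lebesgue_measure]. This gives access to the fundamental theorem of
    calculus for the exponentials below. *)
Lemma ge0_completed_integralE (R : realType) (D : set R) (f : R -> \bar R) :
  measurable D -> measurable_fun [set: R] f -> (forall x, (0 <= f x)%E) ->
  (\int[completed_lebesgue_measure]_(x in D) f x =
   \int[lebesgue_measure]_(x in D) f x)%E.
Proof.
move=> mD mf f0.
have /= <- := @ge0_integral_pushforward _ _
  (caratheodory_type (@wlength R idfun)^*%mu) (measurableTypeR R) R idfun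
  (@lebesgue_measurable_id R) completed_lebesgue_measure D f mD
  (measurable_funTS mf) (fun x _ => f0 x).
by apply: eq_measure_integral => [|A mA _] //; exact: lebesgue_measurable_id.
Qed.

Lemma completed_lebesgue_measure_itv (R : realType) (s t : R) : s <= t ->
  completed_lebesgue_measure `[s, t] = (t - s)%:E.
Proof.
rewrite le_eqVlt => st.
transitivity (lebesgue_measure (`[s, t]%classic : set R)) => //.
rewrite lebesgue_measure_itv/= lte_fin; case: ifP => // ts.
by move: st; rewrite ts orbF => /eqP ->; rewrite subrr.
Qed.

Lemma completed_integral_expR (R : realType) (c s t : R) : c != 0 -> s <= t ->
  (\int[completed_lebesgue_measure]_(x in `[s, t]) (expR (c * x))%:E =
   ((expR (c * t) - expR (c * s)) / c)%:E)%E.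
Proof.
move=> c0 st.
have dF x : is_derive x (1 : R) (fun y => expR (c * y) / c) (expR (c * x)).
  by apply: is_derive_eq; rewrite /GRing.scale/=; field.
have cF : continuous (fun y : R => expR (c * y) / c).
  move=> x; apply: differentiable_continuous; apply/derivable1_diffP.
  exact: (@ex_derive _ _ _ _ _ _ _ (dF x)).
have cf : continuous (fun y : R => expR (c * y)).
  move=> x; apply: differentiable_continuous; apply/derivable1_diffP.
  exact: ex_derive.
rewrite ge0_completed_integralE//; last first.
  by apply: measurableT_comp => //; exact: continuous_measurable_fun.
(* The fundamental theorem of calculus is applied for [s < t]; a one-point interval contributes 0 to
   both sides. *)
move: st; rewrite le_eqVlt => /predU1P[->|st].
  by rewrite set_itv1 integral_set1 subrr mul0r.
rewrite (@continuous_FTC2 _ _ (fun y => expR (c * y) / c))//.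
- by rewrite -EFinB mulrBl.
- exact: continuous_subspaceT.
- split.
  + by move=> x _; exact: (@ex_derive _ _ _ _ _ _ _ (dF x)).
  + by apply/cvg_at_right_filter; exact: cF.
  + by apply/cvg_at_left_filter; exact: cF.
- by move=> x _; rewrite derive1E; exact: (@derive_val _ _ _ _ _ _ _ (dF x)).
Qed.

(** * Lower and upper bounds for integrals of Lebesgue measurable functions *)

Section lebesgue_measurable_bounds.
Context {R : realType}.
Implicit Types (f : R -> R) (s t : R).

Lemma lebesgue_measurable_subitv t0 f s t : t0 <= s ->
  lebesgue_measurable_fun `[t0, +oo[ f -> lebesgue_measurable_fun `[s, t] f.
Proof.
move=> t0s; apply: measurable_funS.
  by apply: borel_lebesgue_measurable; exact: measurable_itv.
move=> x /=; rewrite !in_itv/= andbT => /andP[sx _].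
exact: le_trans sx.
Qed.

Lemma ge_cst_completed_integral f s t m : s <= t -> 0 <= m ->
  lebesgue_measurable_fun `[s, t] f ->
  (forall x, s <= x -> x <= t -> m <= f x) ->
  ((m * (t - s))%:E <=
   \int[completed_lebesgue_measure]_(x in `[s, t]) (f x)%:E)%E.
Proof.
move=> st m0 mf mlef.
have mD : @measurable _ (caratheodory_type (@wlength R idfun)^*%mu)
    `[s, t]%classic.
  by apply: borel_lebesgue_measurable; exact: measurable_itv.
rewrite EFinM -(completed_lebesgue_measure_itv st) -integral_cst//.
apply: ge0_le_integral => //.
- exact/measurable_EFinP.
- move=> x /=; rewrite in_itv/= => /andP[sx xt].
  by rewrite lee_fin mlef.
Qed.

Lemma completed_integral_le_expR f s t a c : c != 0 -> 0 <= a -> s <= t ->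
  lebesgue_measurable_fun `[s, t] f -> (forall x, 0 <= f x) ->
  (forall x, s <= x -> x <= t -> f x <= a * expR (c * x)) ->
  (\int[completed_lebesgue_measure]_(x in `[s, t]) (f x)%:E <=
   (a * ((expR (c * t) - expR (c * s)) / c))%:E)%E.
Proof.
move=> c0 a0 st mf f0 fle.
have mD : @measurable _ (caratheodory_type (@wlength R idfun)^*%mu)
    `[s, t]%classic.
  by apply: borel_lebesgue_measurable; exact: measurable_itv.
have cf : continuous (fun y : R => expR (c * y)).
  move=> x; apply: differentiable_continuous; apply/derivable1_diffP.
  exact: ex_derive.
have me : measurable_fun [set: R] (fun x : R => (expR (c * x))%:E).
  by apply: measurableT_comp => //; exact: continuous_measurable_fun.
rewrite EFinM -completed_integral_expR// -ge0_integralZl//; last first.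
  exact: (lebesgue_measurableT_comp me).
apply: ge0_le_integral => //.
- by move=> x _; rewrite lee_fin.
- exact/measurable_EFinP.
- apply: measurable_funeM; exact: (lebesgue_measurableT_comp me).
- move=> x /=; rewrite in_itv/= => /andP[sx xt].
  by rewrite -EFinM lee_fin fle.
Qed.

End lebesgue_measurable_bounds.

(** * Iteration of one-step estimates *)

(* [E c s t] stands for [f t <= c * f s], or for the time-reversed
   [f s <= c * f t]. *)
Section stepwise_estimates.
Context {R : realType}.
Variables (E : R -> R -> R -> Prop) (t0 : R).
Hypothesis E_trans : forall a b s u t, 0 <= a -> 0 <= b ->
  E a s u -> E b u t -> E (a * b) s t.

(** Cut [[s, t]] into [n] full steps of length [d], each costing a factor [q], and a remainder of
    length at most [d], costing [N]. Both bounds on [n] are kept: the upper one serves the halving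
    case, the lower one the growth case. *)
Lemma stepwise_estimate (q N d : R) : 0 < d -> 0 <= q -> 0 <= N ->
  (forall s, t0 <= s -> E q s (s + d)) ->
  (forall s t, t0 <= s -> s <= t -> t <= s + d -> E N s t) ->
  forall s t, t0 <= s -> s <= t ->
  exists n : nat,
    [/\ n%:R * d <= t - s, t - s <= n.+1%:R * d & E (q ^+ n * N) s t].
Proof.
move=> d0 q0 N0 Eq EN s t t0s st.
have ts0 : 0 <= (t - s) / d by rewrite divr_ge0 ?subr_ge0// ltW.
have := truncn_itv ts0; set n := Num.truncn _ => /andP[].
rewrite ler_pdivlMr// ltr_pdivrMr//.
(* The floor of [(t - s) / d] is replaced by any [n] with [n * d <= t - s <= n.+1 * d], a condition
   that passes to [n - 1] when [s] moves to [s + d]. *)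
move: n => n nd /ltW ndS; exists n; split => //.
elim: n s t0s {st ts0} nd ndS => [|n IH] s t0s nd ndS.
  by rewrite expr0 mul1r; apply: EN => //; lra.
rewrite exprS -mulrA; apply: (@E_trans _ _ _ (s + d)) => //.
- by rewrite mulr_ge0 ?exprn_ge0.
- exact: Eq.
- by apply: IH; [lra|move: nd|move: ndS]; rewrite -natr1 mulrDl mul1r; lra.
Qed.

(** Since [t - s <= n.+1 * d], the exponential is at most [2 ^+ n.+1], while [n] halvings give
    [c = 2^-1 ^+ n * N]. The surplus factor 2 pays for the incomplete last step. *)
Lemma halving_estimate (N d : R) : 0 < d -> 0 <= N ->
  (forall s, t0 <= s -> E 2^-1 s (s + d)) ->
  (forall s t, t0 <= s -> s <= t -> E N s t) ->
  forall s t, t0 <= s -> s <= t ->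
  exists2 c, E c s t & expR (ln 2 / d * (t - s)) * c <= 2 * N.
Proof.
move=> d0 N0 Eh EN s t t0s st.
have h0 : 0 <= 2^-1 :> R by [].
have [n [_ tsn En]] := stepwise_estimate d0 h0 N0 Eh
  (fun s t t0s st _ => EN s t t0s st) t0s st.
exists (2^-1 ^+ n * N) => //; rewrite mulrA ler_wpM2r// exprVn.
rewrite ler_pdivrMr ?exprn_gt0// -exprS.
rewrite -[leRHS](@lnK R) ?posrE ?exprn_gt0// ler_expR lnXn// -[leRHS]mulr_natl.
rewrite mulrAC ler_pdivrMr// [n.+1%:R * _]mulrC -mulrA ler_wpM2l//.
by rewrite ln_ge0// ler1n.
Qed.

(** Here [n <= t - s] bounds [G ^+ n] by [expR (ln G * (t - s))]; the extra factor [G] covers the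
    incomplete last step. *)
Lemma growth_estimate (G : R) : 1 < G ->
  (forall s t, t0 <= s -> s <= t -> t <= s + 1 -> E G s t) ->
  forall s t, t0 <= s -> s <= t ->
  exists2 c, E c s t & c <= G * expR (ln G * (t - s)).
Proof.
move=> G1 EG s t t0s st; have G0 : 0 < G by lra.
have EG1 s' : t0 <= s' -> E G s' (s' + 1) by move=> ?; apply: EG => //; lra.
have [n [nts _ En]] := stepwise_estimate ltr01 (ltW G0) (ltW G0) EG1 EG t0s st.
exists (G ^+ n * G) => //; rewrite mulrC ler_wpM2l ?(ltW G0)//.
rewrite -[leLHS](@lnK R) ?posrE ?exprn_gt0// ler_expR lnXn// -[leLHS]mulr_natl.
rewrite mulrC ler_wpM2l ?ln_ge0 ?(ltW G1)//.
by rewrite mulr1 in nts.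
Qed.

End stepwise_estimates.

(** * The real-valued norm and the cocycle along an invariant family *)

Lemma rnorm_ge0 (R : realType) (k : scalar_kind)
  (V : normedModType (scalar_field R k)) (v : V) : 0 <= rnorm v.
Proof.
rewrite /rnorm; have := normr_ge0 v; move: `|v|; case: k V v => //= V v a.
by rewrite complex.lecE => /andP[].
Qed.

(** Invariance moves the projector past [Phi(s, t0, x)], then the cocycle identity applies. Bounds
    relative to the initial time thus become bounds relative to any later time [s]. *)
Lemma cocycle_restart (R : realType) (k : scalar_kind) (X : Type)
    (V : normedModType (scalar_field R k)) (C : skew_evolution_semiflow X V)
    (P : X -> {linear V -> V}) (t s t0 : R) (x : X) (v : V) :
  intertwines C P -> 0 <= t0 -> t0 <= s -> s <= t ->
  cocycle C t t0 x (P x v) =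
  cocycle C t s (semiflow C s t0 x)
    (P (semiflow C s t0 x) (cocycle C s t0 x v)).
Proof.
move=> CP t00 t0s st; rewrite CP//.
by have [_ _ ->] := cocycleP C.
Qed.

(** * From integral bounds to exponential estimates *)

Section integral_criteria.
Context {R : realType}.
Variables (f : R -> R) (t0 N M : R).
Hypotheses (f0 : forall x, 0 <= f x) (N1 : 1 <= N) (M1 : 1 <= M).
Hypothesis mf : lebesgue_measurable_fun `[t0, +oo[ f.

Let N0 : 0 < N. Proof. exact: lt_le_trans N1. Qed.
Let M0 : 0 < M. Proof. exact: lt_le_trans M1. Qed.
Let d0 : 0 < 2 * N * M. Proof. by rewrite !mulr_gt0. Qed.

Lemma exp_decay :
  (forall s t, t0 <= s -> s <= t -> f t <= N * f s) ->
  (forall s t, t0 <= s -> s <= t ->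
     (\int[completed_lebesgue_measure]_(x in `[s, t]) (f x)%:E <=
      (M * f s)%:E)%E) ->
  forall s t, t0 <= s -> s <= t ->
  expR (ln 2 / (2 * N * M) * (t - s)) * f t <= 2 * N * f s.
Proof.
move=> fN fM s t t0s st.
pose E c s t := f t <= c * f s.
have Et a b s' u t' : 0 <= a -> 0 <= b ->
    E a s' u -> E b u t' -> E (a * b) s' t'.
  move=> a0 b0 Ea Eb; apply: (le_trans Eb).
  by rewrite [a * b]mulrC -mulrA ler_wpM2l.
have Eh s' : t0 <= s' -> E 2^-1 s' (s' + 2 * N * M).
  move=> ts'; rewrite /E.
  have sd : s' <= s' + 2 * N * M by rewrite lerDl ltW.
  (* On this window [f] is at least its final value divided by [N]. The length [2 * N * M] makes the
     integral at least [2 * M] times that value, so comparison with [M * f s'] yields the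
     halving. *)
  have : ((f (s' + 2 * N * M) / N * (s' + 2 * N * M - s'))%:E <= (M * f s')%:E)%E.
    apply: le_trans (fM _ _ ts' sd).
    apply: ge_cst_completed_integral => //.
    - by rewrite divr_ge0// ltW.
    - exact: lebesgue_measurable_subitv mf.
    - move=> x sx xd; rewrite ler_pdivrMr// [leRHS]mulrC.
      by apply: fN => //; exact: le_trans sx.
  rewrite lee_fin addrAC subrr add0r.
  have -> : f (s' + 2 * N * M) / N * (2 * N * M) =
            M * (2 * f (s' + 2 * N * M)) by field; rewrite gt_eqF.
  by rewrite ler_pM2l// [2^-1 * _]mulrC ler_pdivlMr// [leLHS]mulrC.
have [c Ec] := halving_estimate Et d0 (ltW N0) Eh fN t0s st.
move/(ler_wpM2r (f0 s)); apply: le_trans.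
by rewrite -[leRHS]mulrA ler_wpM2l ?expR_ge0.
Qed.

Lemma exp_expansion :
  (forall s t, t0 <= s -> s <= t -> f s <= N * f t) ->
  (forall s t, t0 <= s -> s <= t ->
     (\int[completed_lebesgue_measure]_(x in `[s, t]) (f x)%:E <=
      (M * f t)%:E)%E) ->
  forall s t, t0 <= s -> s <= t ->
  expR (ln 2 / (2 * N * M) * (t - s)) * f s <= 2 * N * f t.
Proof.
move=> fN fM s t t0s st.
pose E c s t := f s <= c * f t.
have Et a b s' u t' : 0 <= a -> 0 <= b ->
    E a s' u -> E b u t' -> E (a * b) s' t'.
  move=> a0 b0 Ea Eb; apply: (le_trans Ea).
  by rewrite -mulrA ler_wpM2l.
have Eh s' : t0 <= s' -> E 2^-1 s' (s' + 2 * N * M).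
  move=> ts'; rewrite /E.
  have sd : s' <= s' + 2 * N * M by rewrite lerDl ltW.
  (* Time reversed: the lower bound on the window now comes from the initial value, and the integral
     is compared with the final one. *)
  have : ((f s' / N * (s' + 2 * N * M - s'))%:E <= (M * f (s' + 2 * N * M))%:E)%E.
    apply: le_trans (fM _ _ ts' sd).
    apply: ge_cst_completed_integral => //.
    - by rewrite divr_ge0// ltW.
    - exact: lebesgue_measurable_subitv mf.
    - by move=> x sx xd; rewrite ler_pdivrMr// [leRHS]mulrC; exact: fN.
  rewrite lee_fin addrAC subrr add0r.
  have -> : f s' / N * (2 * N * M) = M * (2 * f s') by field; rewrite gt_eqF.
  by rewrite ler_pM2l// [2^-1 * _]mulrC ler_pdivlMr// [leLHS]mulrC.
have [c Ec] := halving_estimate Et d0 (ltW N0) Eh fN t0s st.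
move/(ler_wpM2r (f0 t)); apply: le_trans.
by rewrite -[leRHS]mulrA ler_wpM2l ?expR_ge0.
Qed.

End integral_criteria.

(** * From exponential estimates to integral bounds *)

Lemma exp_decay_integral (R : realType) (f : R -> R) (N nu s t : R) :
  0 <= N -> 0 < nu -> s <= t -> (forall x, 0 <= f x) ->
  lebesgue_measurable_fun `[s, t] f ->
  (forall x, s <= x -> x <= t -> expR (nu * (x - s)) * f x <= N * f s) ->
  (\int[completed_lebesgue_measure]_(x in `[s, t]) (f x)%:E <=
   (N / nu * f s)%:E)%E.
Proof.
move=> N0 nu0 st f0 mf fs.
have fle x : s <= x -> x <= t ->
    f x <= (N * f s * expR (nu * s)) * expR (- nu * x).
  move=> sx xt; rewrite -mulrA -expRD.
  have -> : nu * s + - nu * x = - (nu * (x - s)) by ring.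
  by rewrite expRN ler_pdivlMr ?expR_gt0// mulrC fs.
have nuN : - nu != 0 by rewrite oppr_eq0 gt_eqF.
have a0 : 0 <= N * f s * expR (nu * s) by rewrite !mulr_ge0 ?expR_ge0.
apply: (le_trans (completed_integral_le_expR nuN a0 st mf f0 fle)).
rewrite lee_fin.
(* Distributing [expR (nu * s)] turns the bracket into 1 minus an exponential, hence at most 1. *)
have -> : N * f s * expR (nu * s) *
    ((expR (- nu * t) - expR (- nu * s)) / - nu) =
    N / nu * f s * (expR (nu * s) * expR (- nu * s)
                    - expR (nu * s) * expR (- nu * t)).
  by field; rewrite gt_eqF.
rewrite -!expRD mulNr subrr expR0 ler_piMr ?gerBl ?expR_ge0//.
by rewrite mulr_ge0// divr_ge0// ltW.
Qed.

Lemma exp_expansion_integral (R : realType) (f : R -> R) (N nu s t : R) :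
  0 <= N -> 0 < nu -> s <= t -> (forall x, 0 <= f x) ->
  lebesgue_measurable_fun `[s, t] f ->
  (forall x, s <= x -> x <= t -> expR (nu * (t - x)) * f x <= N * f t) ->
  (\int[completed_lebesgue_measure]_(x in `[s, t]) (f x)%:E <=
   (N / nu * f t)%:E)%E.
Proof.
move=> N0 nu0 st f0 mf ft.
have fle x : s <= x -> x <= t ->
    f x <= (N * f t * expR (- nu * t)) * expR (nu * x).
  move=> sx xt; rewrite -mulrA -expRD.
  have -> : - nu * t + nu * x = - (nu * (t - x)) by ring.
  by rewrite expRN ler_pdivlMr ?expR_gt0// mulrC ft.
have nuN : nu != 0 by rewrite gt_eqF.
have a0 : 0 <= N * f t * expR (- nu * t) by rewrite !mulr_ge0 ?expR_ge0.
apply: (le_trans (completed_integral_le_expR nuN a0 st mf f0 fle)).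
rewrite lee_fin.
have -> : N * f t * expR (- nu * t) *
    ((expR (nu * t) - expR (nu * s)) / nu) =
    N / nu * f t * (expR (- nu * t) * expR (nu * t)
                    - expR (- nu * t) * expR (nu * s)).
  by field.
rewrite -!expRD mulNr addNr expR0 ler_piMr ?gerBl ?expR_ge0//.
by rewrite mulr_ge0// divr_ge0// ltW.
Qed.

(** * Equivalence of exponential trichotomy with the integral conditions *)

Theorem theorem3p2 (R : realType) (k : scalar_kind) (X : metricType R)
    (V : completeNormedModType (scalar_field R k))
    (C : skew_evolution_semiflow X V)
    (hmeas : forall (t0 : R) (x : X) (v : V), 0 <= t0 ->
       lebesgue_measurable_fun `[t0, +oo[ (fun s => rnorm (cocycle C s t0 x v))) :
  uniformly_exponentially_trichotomic C <->
  exists P1 P2 P3 : X -> {linear V -> V},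
  exists N M : R,
  exists g : R -> R,
  [/\ compatible C P1 P2 P3,
      1 <= N /\ 1 <= M,
      [/\ forall t, 0 <= t -> 1 < g t,
          forall t u, 0 <= t -> t <= u -> g t <= g u &
          g t @[t --> +oo] --> +oo] &
      forall (t s t0 : R) (x : X) (v : V), 0 <= t0 -> t0 <= s -> s <= t ->
      [/\ rnorm (cocycle C t t0 x (P1 x v)) <= N * rnorm (P1 x v) /\
          (\int[completed_lebesgue_measure]_(tau in `[s, t])
             (rnorm (cocycle C tau t0 x (P1 x v)))%:E
           <= (M * rnorm (cocycle C s t0 x (P1 x v)))%:E)%E,
          rnorm (P2 x v) <= N * rnorm (cocycle C t t0 x (P2 x v)) /\
          (\int[completed_lebesgue_measure]_(tau in `[s, t])
             (rnorm (cocycle C tau t0 x (P2 x v)))%:E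
           <= (M * rnorm (cocycle C t t0 x (P2 x v)))%:E)%E &
          rnorm (cocycle C t t0 x (P3 x v))
            <= g (t - s) * rnorm (cocycle C s t0 x (P3 x v)) /\
          rnorm (cocycle C s t0 x (P3 x v))
            <= g (t - s) * rnorm (cocycle C t t0 x (P3 x v))]].
Proof.
have Phi0 t x v : 0 <= t -> cocycle C t t x v = v.
  by have [_ + _] := cocycleP C; exact.
split.
- move=> [P1 [P2 [P3 [N1 [N2 [N3 [nu1 [nu2 [nu3]]]]]]]]].
  move=> [CP [N11 N21 N31] [nu10 nu20 nu30] H].
  have [N10 N20] : 0 <= N1 /\ 0 <= N2 by split; lra.
  have Nnu1 : 0 <= N1 / nu1 by rewrite divr_ge0// ltW.
  have Nnu2 : 0 <= N2 / nu2 by rewrite divr_ge0// ltW.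
  (* Sums dominate the constants of both [P1] and [P2]; the leading 1 ensures [1 <= M]. In [g],
     using [N3 + 1] instead of [N3] gives the strict bound [1 < g t] even at [t = 0]. *)
  exists P1, P2, P3, (N1 + N2), (1 + N1 / nu1 + N2 / nu2).
  exists (fun t => (N3 + 1) * expR (nu3 * t)).
  have N30 : 0 < N3 + 1 by lra.
  split => //; first by split; lra.
    split.
    + move=> t t0; have N31' : 1 < N3 + 1 by lra.
      rewrite (lt_le_trans N31')// ler_peMr ?(ltW N30)//.
      by rewrite -expR0 ler_expR mulr_ge0// ltW.
    + by move=> t u _ tu; rewrite ler_pM2l// ler_expR ler_pM2l.
    + apply: gt0_cvgMry => //.
      (* Divergence follows from [nu3 * t <= 1 + nu3 * t <= expR (nu3 * t)]. *)
      apply: (@ger_cvgy _ _ _ _ (fun t => nu3 * t)).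
        by near=> t; rewrite (le_trans _ (expR_ge1Dx _))// lerDr.
      exact: gt0_cvgMry.
  move=> t s t0 x v t00 t0s st.
  have s0 := le_trans t00 t0s; have t0t := le_trans t0s st.
  split.
  + split.
      (* With [s = t0] the cocycle on the right is the identity, which leaves the norm of
         [P1 x v]. *)
      have [+ _ _ _] := H t t0 t0 x v t00 (lexx _) t0t.
      rewrite Phi0// => le1.
      have e1 : 1 <= expR (nu1 * (t - t0)).
        by rewrite -expR0 ler_expR mulr_ge0 ?subr_ge0// ltW.
      apply: le_trans (ler_peMl (rnorm_ge0 _) e1) _.
      by apply: le_trans le1 _; rewrite ler_wpM2r ?rnorm_ge0// lerDl.
    apply: le_trans (exp_decay_integral N10 nu10 st _ _ _) _.
    * by move=> y; exact: rnorm_ge0.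
    * exact: (lebesgue_measurable_subitv t0s (hmeas _ _ _ t00)).
    * by move=> y sy yt; have [] := H y s t0 x v t00 t0s sy.
    * by rewrite lee_fin ler_wpM2r ?rnorm_ge0//; lra.
  + split.
      have [_ + _ _] := H t t0 t0 x v t00 (lexx _) t0t.
      rewrite Phi0// => le1.
      have e1 : 1 <= expR (nu2 * (t - t0)).
        by rewrite -expR0 ler_expR mulr_ge0 ?subr_ge0// ltW.
      apply: le_trans (ler_peMl (rnorm_ge0 _) e1) _.
      by apply: le_trans le1 _; rewrite ler_wpM2r ?rnorm_ge0// lerDr.
    apply: le_trans (exp_expansion_integral N20 nu20 st _ _ _) _.
    * by move=> y; exact: rnorm_ge0.
    * exact: (lebesgue_measurable_subitv t0s (hmeas _ _ _ t00)).
    * move=> y sy yt; have [] // := H t y t0 x v t00 _ yt.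
      exact: le_trans sy.
    * by rewrite lee_fin ler_wpM2r ?rnorm_ge0//; lra.
  + have [_ _ h1 h2] := H t s t0 x v t00 t0s st.
    by split; [apply: le_trans h1 _|apply: le_trans h2 _];
      rewrite ler_wpM2r ?rnorm_ge0// ler_wpM2r ?expR_ge0// lerDl.
- move=> [P1 [P2 [P3 [N [M [g [CP [N1 M1] [g1 gmono _] H]]]]]]].
  have [_ _ _ [I1 I2 I3]] := CP.
  have NM0 : 0 < ln 2 / (2 * N * M).
    by rewrite divr_gt0 ?ln_gt0 ?ltr1n// !mulr_gt0//; lra.
  have G1 := g1 _ (@ler01 R).
  (* The rate [ln 2 / (2 * N * M)] is one halving per step of length [2 * N * M]; [ln (g 1)] is the
     growth rate per unit step, positive because [1 < g 1]. *)
  exists P1, P2, P3, (2 * N), (2 * N), (g 1).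
  exists (ln 2 / (2 * N * M)), (ln 2 / (2 * N * M)), (ln (g 1)).
  split => //; first by split; lra.
    by split => //; rewrite ln_gt0.
  move=> t s t0 x v t00 t0s st; split.
  + apply: (exp_decay (t0 := t0)
      (f := fun s => rnorm (cocycle C s t0 x (P1 x v)))) => //.
    * by move=> y; exact: rnorm_ge0.
    * exact: hmeas.
    (* Condition (i) only compares with the initial time, so it is applied with initial time [a], at
       the point [semiflow C a t0 x] and the vector [cocycle C a t0 x v]. *)
    * move=> a b t0a ab; have a0 := le_trans t00 t0a.
      rewrite (cocycle_restart _ _ I1 t00 t0a ab) -(I1 a t0)//.
      by have [[]] := H b a a (semiflow C a t0 x) (cocycle C a t0 x v) a0
        (lexx _) ab.
    * by move=> a b t0a ab; have [[]] := H b a t0 x v t00 t0a ab.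
  + apply: (exp_expansion (t0 := t0)
      (f := fun s => rnorm (cocycle C s t0 x (P2 x v)))) => //.
    * by move=> y; exact: rnorm_ge0.
    * exact: hmeas.
    * move=> a b t0a ab; have a0 := le_trans t00 t0a.
      rewrite (cocycle_restart _ _ I2 t00 t0a ab) -(I2 a t0)//.
      by have [_ []] := H b a a (semiflow C a t0 x) (cocycle C a t0 x v) a0
        (lexx _) ab.
    * by move=> a b t0a ab; have [_ []] := H b a t0 x v t00 t0a ab.
  + pose E c s t := rnorm (cocycle C t t0 x (P3 x v)) <=
      c * rnorm (cocycle C s t0 x (P3 x v)).
    have Et a b s' u t' : 0 <= a -> 0 <= b ->
        E a s' u -> E b u t' -> E (a * b) s' t'.
      move=> a0 b0 Ea Eb; apply: (le_trans Eb).
      by rewrite [a * b]mulrC -mulrA ler_wpM2l.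
    (* Monotonicity of [g] gives the single constant [g 1] for all steps of length at most 1. *)
    have EG s' t' : t0 <= s' -> s' <= t' -> t' <= s' + 1 -> E (g 1) s' t'.
      move=> t0s' st' ts'; have [_ _ [+ _]] := H t' s' t0 x v t00 t0s' st'.
      move=> /le_trans; apply; rewrite ler_wpM2r ?rnorm_ge0// gmono ?subr_ge0//.
      by rewrite lerBlDl.
    have [c Ec cle] := growth_estimate Et G1 EG t0s st.
    by apply: (le_trans Ec); rewrite ler_wpM2r ?rnorm_ge0.
  + pose E c s t := rnorm (cocycle C s t0 x (P3 x v)) <=
      c * rnorm (cocycle C t t0 x (P3 x v)).
    have Et a b s' u t' : 0 <= a -> 0 <= b ->
        E a s' u -> E b u t' -> E (a * b) s' t'.
      move=> a0 b0 Ea Eb; apply: (le_trans Ea).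
      by rewrite -mulrA ler_wpM2l.
    have EG s' t' : t0 <= s' -> s' <= t' -> t' <= s' + 1 -> E (g 1) s' t'.
      move=> t0s' st' ts'; have [_ _ [_ +]] := H t' s' t0 x v t00 t0s' st'.
      move=> /le_trans; apply; rewrite ler_wpM2r ?rnorm_ge0// gmono ?subr_ge0//.
      by rewrite lerBlDl.
    have [c Ec cle] := growth_estimate Et G1 EG t0s st.
    by apply: (le_trans Ec); rewrite ler_wpM2r ?rnorm_ge0.
Unshelve. all: by end_near. Qed.
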